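(* Let $n\ge 0$ be an integer and let $G$ be a connected graph with exactly $n$ edges. Then \[\mathrm{copsi}(G)\le \mathrm{copsi}(\mathsf{K}_{1,n}),\] and if $\mathrm{copsi}(G)=\mathrm{copsi}(\mathsf{K}_{1,n})$, then $G$ is isomorphic to $\mathsf{K}_{1,n}$.
   Context: A graph is a set of vertices together with a set of two-element subsets of it (edges); the size of a graph is its number of edges and its order is its number of vertices. A partial symmetry of a graph $G$ is a triple $(U,V,f)$ where $U$ and $V$ are induced subgraphs of $G$ and $f\colon U\to V$ is a graph isomorphism. It is a connected partial symmetry if $U$ (equivalently $V$) is non-empty and connected. The connected partial symmetry index $\mathrm{copsi}(G)$ is the number of connected partial symmetries of $G$. $\mathsf{K}_{1,n}$ denotes the star with $n$ rays, i.e. the complete bipartite graph with one vertex adjacent to each of $n$ other vertices (and no other edges). *)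

(* Defs.v *)
From mathcomp Require Import all_boot.
Set Implicit Arguments.
Unset Strict Implicit.
Unset Printing Implicit Defensive.

(* A symmetric irreflexive relation is the same thing as a set of two-element
   subsets.  A connected graph with finitely many edges has finitely many
   vertices, so finite vertex types lose no generality here. *)
Record sgraph := SGraph {
  vertex :> finType;
  adj : rel vertex;
  adj_sym : symmetric adj;
  adj_irr : irreflexive adj
}.

Definition edges (G : sgraph) : {set {set G}} :=
  [set e : {set G} | [exists x : G, exists y : G, adj x y && (e == [set x; y])]].

(* The empty graph satisfies this predicate; non-emptiness is requested
   separately where it is needed. *)
Definition connected (G : sgraph) : bool :=
  [forall x : G, forall y : G, connect (@adj G) x y].

Section Induced.
Variables (G : sgraph) (U : {set G}).

Definition induced_adj : rel {x : G | x \in U} := fun x y => adj (val x) (val y).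

Fact induced_adj_sym : symmetric induced_adj.
Proof. by move=> x y; apply: adj_sym. Qed.

Fact induced_adj_irr : irreflexive induced_adj.
Proof. by move=> x; apply: adj_irr. Qed.

Definition induced : sgraph := SGraph induced_adj_sym induced_adj_irr.

End Induced.

Definition is_iso (G H : sgraph) (f : {ffun G -> H}) : bool :=
  [&& injectiveb f,
      [forall y : H, exists x : G, f x == y]
    & [forall x : G, forall y : G, adj (f x) (f y) == adj x y]].

Definition isomorphic (G H : sgraph) : Prop :=
  exists f : {ffun G -> H}, is_iso f.

(* A triple (U, V, f), with f an arbitrary map from U to V; an induced subgraph
   is identified with its vertex set. *)
Definition partial_map (G : sgraph) : finType :=
  {UV : {set G} * {set G} & {ffun induced UV.1 -> induced UV.2}}.

Definition is_partial_symmetry (G : sgraph) (s : partial_map G) : bool :=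
  is_iso (tagged s).

Definition is_connected_partial_symmetry (G : sgraph) (s : partial_map G) :
    bool :=
  [&& is_partial_symmetry s, (tag s).1 != set0 & connected (induced (tag s).1)].

Definition copsi (G : sgraph) : nat :=
  #|[set s : partial_map G | is_connected_partial_symmetry s]|.

Section Star.
Variable n : nat.

(* None is the centre, Some i is the end of the i-th ray. *)
Definition star_adj : rel (option 'I_n) := fun x y => (x == None) (+) (y == None).

Fact star_adj_sym : symmetric star_adj.
Proof. by move=> x y; apply: addbC. Qed.

Fact star_adj_irr : irreflexive star_adj.
Proof. by move=> x; apply: addbb. Qed.

Definition star : sgraph := SGraph star_adj_sym star_adj_irr.

End Star.

(* Main.v *)
(* A partial symmetry F with connected domain of at least three vertices is
   determined by the partial injection it induces on edges: a vertex with two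
   incident edges in the domain is their intersection, and every other vertex of
   the domain is a neighbour of such a vertex.  Hence, with n edges, there are at
   most as many such F as partial injections of an n-set with at least two points
   in the domain, while domains of one and two vertices contribute |G|^2 and
   2 n^2.  As |G| <= n + 1 and the star attains all three bounds, the inequality
   follows.  In case of equality, the identity on any two edges is induced by some
   F, so any two edges span a connected subgraph with no third edge; then all edges
   share a vertex and G is a star. *)
Require Import Defs.
From mathcomp Require Import all_boot.
Set Implicit Arguments.
Unset Strict Implicit.
Unset Printing Implicit Defensive.

(** * Connected partial symmetries as partial functions on the vertices *)

Section PartialFunctions.
Variable G : sgraph.
Implicit Types (x y z : G) (U A : {set G}) (F : {ffun G -> option G}).

(** Induction along a path inside [U]. It serves to bound a connected [U] by a small set [A] closed
    under adjacency within [U]. *)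
Lemma connected_closed U A x :
  connected (induced U) -> x \in U -> x \in A ->
  (forall y z, y \in U -> z \in U -> y \in A -> adj y z -> z \in A) -> U \subset A.
Proof.
move=> /forallP Uc xU xA Acl; apply/subsetP => y yU.
have /connectP[p pP eqy] := forallP (Uc (exist _ x xU)) (exist _ y yU).
have -> : y = val (last (exist _ x xU) p : induced U) by rewrite -eqy.
have {}xA : val (exist _ x xU : induced U) \in A by [].
elim: p (exist _ x xU) pP xA {eqy} => //= z p IHp w /andP[wz zp] wA.
apply: (IHp _ zp); exact: (Acl (val w) (val z) (valP w) (valP z) wA wz).
Qed.

Lemma connected_hub U c :
  c \in U -> (forall x, x \in U -> x != c -> adj c x) -> connected (induced U).
Proof.
move=> cU Uc.
have hub (u : induced U) : connect (@adj (induced U)) (exist _ c cU) u.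
  have [-> | ne] := eqVneq u (exist _ c cU); first exact: connect0.
  by apply: connect1; apply: Uc; [apply: valP | rewrite -val_eqE in ne].
apply/forallP => u; apply/forallP => v; apply: connect_trans (hub v).
rewrite (sym_connect_sym (@adj_sym (induced U))); exact: hub.
Qed.

Definition dom F := [set x | isSome (F x)].

Lemma domP F x : reflect (exists y, F x = Some y) (x \in dom F).
Proof.
by rewrite inE; case: (F x) => [y|]; constructor; [exists y | case].
Qed.

(** The clause on equality makes [F] injective on its domain. *)
Definition preserves_adj F :=
  [forall x, forall y, if (F x, F y) is (Some u, Some v)
                       then (adj u v == adj x y) && ((u == v) == (x == y)) else true].

(* Connected partial symmetries, encoded as partial functions on the vertices
   that are None outside U. *)
Definition cps F :=
  [&& preserves_adj F, dom F != set0 & connected (induced (dom F))].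

Lemma preserves_adjP F :
  reflect (forall x y u v, F x = Some u -> F y = Some v ->
             adj u v = adj x y /\ (u == v) = (x == y))
          (preserves_adj F).
Proof.
apply: (iffP forallP) => [H x y u v Fx Fy | H x].
  by have := forallP (H x) y; rewrite Fx Fy => /andP[/eqP-> /eqP->].
apply/forallP => y; case Fx: (F x) => [u|] //; case Fy: (F y) => [v|] //.
by have [-> ->] := H _ _ _ _ Fx Fy; rewrite !eqxx.
Qed.

Lemma cps_adj F x y u v :
  cps F -> F x = Some u -> F y = Some v -> adj u v = adj x y.
Proof. by case/and3P=> /preserves_adjP H _ _ Fx Fy; have [] := H _ _ _ _ Fx Fy. Qed.

Lemma cps_inj F x y u : cps F -> F x = Some u -> F y = Some u -> x = y.
Proof.
case/and3P=> /preserves_adjP H _ _ Fx Fy; have [_] := H _ _ _ _ Fx Fy.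
by rewrite eqxx => /esym/eqP.
Qed.

Definition graph_of (s : partial_map G) : {ffun G -> option G} :=
  [ffun x => omap (fun u => val (tagged s u)) (insub x)].

Lemma graph_ofE (s : partial_map G) (u : induced (tag s).1) :
  graph_of s (val u) = Some (val (tagged s u)).
Proof. by rewrite ffunE valK. Qed.

Lemma dom_graph_of s : dom (graph_of s) = (tag s).1.
Proof.
apply/setP => x; rewrite inE ffunE.
by case: insubP => [u -> | /negbTE ->].
Qed.

(** The domain of [graph_of s] recovers [U], and surjectivity of [f] recovers [V] as the image. *)
Lemma graph_of_inj :
  {in [set s | @is_partial_symmetry G s] &, injective graph_of}.
Proof.
move=> s s' + + eqF; have eqU := congr1 dom eqF.
have E u := graph_ofE (s := s) u; have E' u := graph_ofE (s := s') u.
rewrite !dom_graph_of in eqU; rewrite -eqF in E' => {eqF}.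
case: s s' E E' eqU => [[U V] f] [[U' V'] f'] /= E E' eqU; subst U'.
rewrite !inE /is_partial_symmetry /=.
case/and3P=> _ /forallP /= fsurj _ /and3P[_ /forallP /= fsurj' _].
have eqf (u : induced U) : val (f u) = val (f' u).
  by have := E u; rewrite E' => -[].
have eqV : V = V'.
  apply/setP => y; apply/idP/idP => yV.
    have /existsP[u /eqP fu] := fsurj (exist _ y yV).
    by have := valP (f' u); rewrite -eqf fu.
  have /existsP[u /eqP fu] := fsurj' (exist _ y yV).
  by have := valP (f u); rewrite eqf fu.
subst V'; congr existT; apply/ffunP => u; apply: val_inj; exact: eqf.
Qed.

Lemma cps_graph_of s :
  is_connected_partial_symmetry s -> cps (graph_of s).
Proof.
case: s => [[U V] f]; rewrite /is_connected_partial_symmetry.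
rewrite /is_partial_symmetry /cps dom_graph_of /= => /and3P[/and3P[]].
move=> /injectiveP finj _ /forallP fadj -> ->; rewrite !andbT.
apply/preserves_adjP => x y u v; rewrite !ffunE /=.
case: insubP => //= x' _ <- [<-]; case: insubP => //= y' _ <- [<-].
split; first exact/eqP/(forallP (fadj x')).
by rewrite !val_eqE (inj_eq finj).
Qed.

Lemma cps_graph_of_ex F :
  cps F -> exists2 s, is_connected_partial_symmetry s & graph_of s = F.
Proof.
move=> Fcps; have /and3P[/preserves_adjP Fp Fn Fc] := Fcps.
(* Taking the image of [F] as codomain makes the resulting map surjective. *)
pose V := [set y | [exists x, F x == Some y]].
have [f fP] : exists f : induced (dom F) -> induced V,
    forall u, F (val u) = Some (val (f u)).
  apply: (fin_all_exists (P := fun u v => F (val u) = Some (val v))) => u.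
  have /domP[y Fy] := valP u.
  have yV : y \in V by rewrite inE; apply/existsP; exists (val u); apply/eqP.
  by exists (exist _ y yV).
pose s : partial_map G := existT _ (dom F, V) [ffun u => f u].
exists s; last first.
  apply/ffunP => x; rewrite ffunE; case: insubP => [u _ <- | ] /=.
    by rewrite ffunE fP.
  by rewrite inE; case: (F x).
apply/and3P; split=> //; apply/and3P; split=> /=.
- apply/injectiveP => u v; rewrite !ffunE => fuv; apply: val_inj.
  by apply: cps_inj Fcps (fP u) _; rewrite fuv fP.
- apply/forallP => y; have := valP y; rewrite inE => /existsP[x /eqP Fx].
  have xU : x \in dom F by apply/domP; exists (val y).
  apply/existsP; exists (exist _ x xU); rewrite ffunE -val_eqE.
  by have := fP (exist _ x xU); rewrite Fx => -[/esym/eqP].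
- apply/forallP => u; apply/forallP => v; rewrite !ffunE.
  by apply/eqP; apply: cps_adj Fcps (fP u) (fP v).
Qed.

Lemma copsiE : copsi G = #|[set F | cps F]|.
Proof.
rewrite /copsi -(@card_in_imset _ _ graph_of); last first.
  move=> s t; rewrite !inE => /and3P[sP _ _] /and3P[tP _ _].
  by apply: graph_of_inj; rewrite inE.
apply: eq_card => F; rewrite [RHS]inE; apply/imsetP/idP => [[s]|].
  by rewrite inE => /cps_graph_of sP ->.
by case/cps_graph_of_ex => s sP <-; exists s; rewrite ?inE.
Qed.

(** * Splitting by the size of the domain, and domains with one vertex *)

Definition cps_card (P : pred nat) := [set F | cps F & P #|dom F|].

Lemma copsi_sum :
  copsi G = #|cps_card (pred1 1)| + #|cps_card (pred1 2)| + #|cps_card (leq 3)|.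
Proof.
rewrite copsiE -(cardsID [set F | #|dom F| <= 2]).
rewrite -(cardsID [set F | #|dom F| == 1] (_ :&: _)); congr (_ + _ + _).
- apply: eq_card => F; rewrite !inE -andbA /=; congr (_ && _).
  by case: (#|dom F|) => [|[|[]]].
- apply: eq_card => F; rewrite !inE /= andbCA; apply: andb_id2l => Fc.
  (* [cps] excludes the empty domain, so a size at most 2 and different from 1 is 2. *)
  have /and3P[_ + _] := Fc; rewrite -card_gt0 /=.
  by case: (#|dom F|) => [|[|[]]].
- by apply: eq_card => F; rewrite !inE /= -ltnNge andbC.
Qed.

(** A single vertex may be sent to any vertex, so the pair of source and target is free. *)
Lemma card_cps1 : #|cps_card (pred1 1)| = #|G| ^ 2.
Proof.
pose psi (q : G * G) : {ffun G -> option G} := [ffun x => if x == q.1 then Some q.2 else None].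
have dom_psi q : dom (psi q) = [set q.1].
  by apply/setP => x; rewrite !inE ffunE; case: eqP.
have psi_inj : injective psi.
  move=> [x y] [x' y'] eqp.
  have := congr1 dom eqp; rewrite !dom_psi /= => /set1_inj eqx; subst x'.
  by have /ffunP/(_ x) := eqp; rewrite !ffunE /= eqxx => -[->].
rewrite -mulnn -card_prod -cardsT -(card_imset _ psi_inj).
apply: eq_card => F; rewrite !inE; apply/andP/imsetP => [[Fc /cards1P[x dF]]|].
  have /domP[y Fx] : x \in dom F by rewrite dF set11.
  exists (x, y) => //; apply/ffunP => z; rewrite ffunE /=.
  case: eqP => [->//|/eqP zx].
  have : z \notin dom F by rewrite dF inE.
  by rewrite inE; case: (F z).
case=> -[x y] _ ->; rewrite dom_psi cards1; split=> //.
rewrite /cps dom_psi; apply/and3P; split.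
- apply/preserves_adjP => u v u' v'; rewrite !ffunE /=.
  by case: eqP => // -> [<-]; case: eqP => // -> [<-]; rewrite !adj_irr !eqxx.
- by rewrite -card_gt0 cards1.
- apply: (@connected_hub _ x); first by rewrite set11.
  by move=> z; rewrite inE => ->.
Qed.

(** Otherwise [[set x]] would be closed under adjacency within [U] and would contain [U]. *)
Lemma connected_neighbour U x :
  connected (induced U) -> 1 < #|U| -> x \in U ->
  exists2 y, y \in U & adj x y.
Proof.
move=> Uc U1 xU; apply/exists_inP; apply: contraLR U1 => /exists_inPn xn.
rewrite -leqNgt -(cards1 x) subset_leq_card //.
apply: connected_closed Uc xU (set11 x) _ => y z yU zU.
by rewrite inE => /eqP -> xz; rewrite (negbTE (xn z zU)) in xz.
Qed.

(** Otherwise [[set x; y]] would be closed under adjacency within [U] and would contain [U]. *)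
Lemma connected_third U x y :
  connected (induced U) -> 2 < #|U| -> x \in U -> y \in U -> adj x y ->
  exists2 z, z \in U & [&& z != x, z != y & adj x z || adj y z].
Proof.
move=> Uc U2 xU yU xy; apply/exists_inP; apply: contraLR U2 => /exists_inPn xn.
have c2 : #|[set x; y]| <= 2 by rewrite cards2; case: eqP.
rewrite -leqNgt; apply: leq_trans c2; apply: subset_leq_card.
apply: connected_closed Uc xU (set21 x y) _ => w z _ zU.
move=> wxy wz; have := xn z zU; rewrite !inE.
case: eqP => //= _; case: eqP => //= _.
by case/set2P: wxy wz => <- ->; rewrite ?orbT.
Qed.

End PartialFunctions.

(** * Unordered pairs and partial injections *)

Lemma set2_eq_cases (T : finType) (x y u v : T) :
  [set x; y] = [set u; v] -> x = u /\ y = v \/ x = v /\ y = u.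
Proof.
move=> e.
have /set2P Hx : x \in [set u; v] by rewrite -e set21.
have /set2P Hy : y \in [set u; v] by rewrite -e set22.
have /set2P Hu : u \in [set x; y] by rewrite e set21.
have /set2P Hv : v \in [set x; y] by rewrite e set22.
case: Hx Hy Hu Hv => [] ? [] ? [] ? [] ?; subst; solve [by left | by right].
Qed.

Definition partial_inj (T : finType) (p : {ffun T -> option T}) :=
  [forall i, forall j, p i ==> (p i == p j) ==> (i == j)].

Lemma partial_injP (T : finType) (p : {ffun T -> option T}) :
  reflect (forall i j k, p i = Some k -> p j = Some k -> i = j) (partial_inj p).
Proof.
apply: (iffP forallP) => [H i j k pi pj | H i].
  by have := forallP (H i) j; rewrite pi pj eqxx => /eqP.
apply/forallP => j; case pi: (p i) => [k|] //=.
by apply/implyP => /eqP/esym pj; apply/eqP/H/pj.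
Qed.

(** The bound reflects that a connected set of at least three vertices contains at least two
    edges. *)
Definition partial_injs n :=
  [set p : {ffun 'I_n -> option 'I_n} | partial_inj p & 1 < #|[set i | p i]|].

(** * Partial symmetries of a graph with enumerated edges *)

Section EdgeFamily.
Variables (n : nat) (G : sgraph) (a b : 'I_n -> G).
Implicit Types (x y z : G) (F : {ffun G -> option G}).

Definition edge_of i := [set a i; b i].

(** The ends of each edge come in an arbitrary order. Indexing by ['I_n] lets [G] and the star be
    compared over one index set. *)
Definition edge_family :=
  [/\ forall i, adj (a i) (b i), injective edge_of
    & forall x y, adj x y -> exists i, edge_of i = [set x; y]].

Hypothesis ef : edge_family.

Let adj_ab i : adj (a i) (b i). Proof. by case: ef. Qed.
Let ed_inj : injective edge_of. Proof. by case: ef. Qed.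
Let ed_ex x y : adj x y -> exists i, edge_of i = [set x; y]. Proof. by case: ef => _ _; apply. Qed.
Let b_neq_a i : b i != a i.
Proof. by apply: contraTneq (adj_ab i) => ->; rewrite adj_irr. Qed.

Lemma adj_ed i x y : edge_of i = [set x; y] -> adj x y.
Proof. by case/set2_eq_cases => -[<- <-]; rewrite // adj_sym. Qed.

(** A connected domain of two vertices is an edge [i], sent to an edge [j] in one of two ways,
    recorded by the bit [c]. *)
Lemma card_cps2 : #|cps_card G (pred1 2)| = 2 * n ^ 2.
Proof.
pose psi (q : 'I_n * 'I_n * bool) : {ffun G -> option G} :=
  let: (i, j, c) := q in
  [ffun x => if x == a i then Some (if c then a j else b j)
             else if x == b i then Some (if c then b j else a j) else None].
have psi_a i j c : psi (i, j, c) (a i) = Some (if c then a j else b j).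
  by rewrite ffunE eqxx.
have psi_b i j c : psi (i, j, c) (b i) = Some (if c then b j else a j).
  by rewrite ffunE (negbTE (b_neq_a i)) eqxx.
have dom_psi i j c : dom (psi (i, j, c)) = edge_of i.
  by apply/setP => x; rewrite !inE ffunE; do 2!case: eqP.
have psi_inj : injective psi.
  move=> [[i j] c] [[i' j'] c'] eqp.
  have := congr1 (@dom G) eqp; rewrite !dom_psi => /ed_inj eqi; subst i'.
  have := psi_a i j' c'; have := psi_b i j' c'.
  rewrite -eqp psi_a psi_b => -[eb] [ea].
  have eqj : j = j'.
    apply: ed_inj; rewrite /edge_of.
    by case: c c' ea eb {eqp} => -[] /= -> -> //; rewrite setUC.
  subst j'; case: c c' ea eb {eqp} => -[] //= ea _; have := b_neq_a j.
    by rewrite ea eqxx.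
  by rewrite -ea eqxx.
have -> : 2 * n ^ 2 = #|{: 'I_n * 'I_n * bool}|.
  by rewrite !card_prod card_bool card_ord mulnC mulnn.
rewrite -cardsT -(card_imset _ psi_inj).
apply: eq_card => F; rewrite !inE; apply/andP/imsetP => [[Fc /cards2P[x [y [xy dF]]]]|].
  have /domP[u Fx] : x \in dom F by rewrite dF set21.
  have /domP[v Fy] : y \in dom F by rewrite dF set22.
  have Fz z : z != x -> z != y -> F z = None.
    move=> /negbTE zx /negbTE zy; have : z \notin dom F by rewrite dF !inE zx zy.
    by rewrite inE; case: (F z).
  have axy : adj x y.
    have /and3P[_ _ conn] := Fc; rewrite dF in conn.
    have [|w wxy xw] := connected_neighbour conn _ (set21 x y).
      by rewrite cards2 xy.
    by case/set2P: wxy xw => -> //; rewrite adj_irr.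
  have /ed_ex[j] : adj u v by rewrite (cps_adj Fc Fx Fy).
  have [i] := ed_ex axy.
  (* The bit is [true] exactly when [F] respects the chosen orders of the ends of [i] and [j]. *)
  case/set2_eq_cases => -[ai bi]; case/set2_eq_cases => -[aj bj].
  - exists (i, j, true) => //; apply/ffunP => z; rewrite ffunE ai bi aj bj.
    case: eqP => [->//|/eqP zx]; case: eqP => [->//|/eqP zy]; exact: Fz.
  - exists (i, j, false) => //; apply/ffunP => z; rewrite ffunE ai bi aj bj.
    case: eqP => [->//|/eqP zx]; case: eqP => [->//|/eqP zy]; exact: Fz.
  - exists (i, j, false) => //; apply/ffunP => z; rewrite ffunE ai bi aj bj.
    case: eqP => [->//|/eqP zy]; case: eqP => [->//|/eqP zx]; exact: Fz.
  - exists (i, j, true) => //; apply/ffunP => z; rewrite ffunE ai bi aj bj.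
    case: eqP => [->//|/eqP zy]; case: eqP => [->//|/eqP zx]; exact: Fz.
case=> -[[i j] c] _ ->; rewrite dom_psi cards2 (eq_sym (a i)) b_neq_a; split=> //.
rewrite /cps dom_psi; apply/and3P; split.
- have [bi bj] := (negbTE (b_neq_a i), negbTE (b_neq_a j)).
  have ab := adj_ab; have ba k : adj (b k) (a k) by rewrite adj_sym.
  apply/preserves_adjP => u v u' v'; rewrite !ffunE.
  case: eqP => [->|_]; last case: eqP => [->|//]; move=> [<-];
  (case: eqP => [->|_]; last case: eqP => [->|//]); move=> [<-];
  by case: c; rewrite ?adj_irr ?eqxx ?ab ?ba ?bi ?bj // eq_sym ?bi ?bj // eq_sym ?bi ?bj.
- by apply/set0Pn; exists (a i); apply: set21.
- apply: (@connected_hub _ _ (a i)); first by rewrite set21.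
  by move=> z /set2P[] ->; rewrite ?eqxx.
Qed.

(** * The partial injection induced on edges *)

(** [None] stands for edges with an end outside the domain; under [cps F] the [pick] succeeds on all
    others, since [F] preserves adjacency. *)
Definition edge_map F : {ffun 'I_n -> option 'I_n} :=
  [ffun i => if (F (a i), F (b i)) is (Some x, Some y)
             then [pick j | edge_of j == [set x; y]] else None].

Lemma edge_mapP F i x y j u v :
  cps F -> edge_of i = [set x; y] -> F x = Some u -> F y = Some v ->
  edge_map F i = Some j <-> edge_of j = [set u; v].
Proof.
move=> Fc eqi Fx Fy; rewrite ffunE.
have -> : (if (F (a i), F (b i)) is (Some x, Some y)
             then [pick j | edge_of j == [set x; y]] else None)
          = [pick j | edge_of j == [set u; v]].
  case/set2_eq_cases: eqi => -[-> ->]; rewrite Fx Fy //.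
  by apply: eq_pick => k; rewrite /= setUC.
case: pickP => [k /eqP ek|none]; split=> //.
- by case=> <-.
- by move=> ej; congr Some; apply: ed_inj; rewrite ej.
- by move=> ej; have := none j; rewrite ej eqxx.
Qed.

Lemma edge_map_dom F i :
  cps F -> edge_map F i = (a i \in dom F) && (b i \in dom F) :> bool.
Proof.
move=> Fc; apply/idP/andP => [|[/domP[u Fa] /domP[v Fb]]].
  by rewrite ffunE !inE; case: (F (a i)) => // u; case: (F (b i)).
have /ed_ex[j ej] : adj u v by rewrite (cps_adj Fc Fa Fb).
by have /(_ j) [_ /(_ ej) ->] := edge_mapP _ Fc (erefl (edge_of i)) Fa Fb.
Qed.

Lemma edge_map_edge F i j :
  cps F -> edge_map F i = Some j ->
  exists u v, [/\ F (a i) = Some u, F (b i) = Some v & edge_of j = [set u; v]].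
Proof.
move=> Fc Fi; have := edge_map_dom i Fc; rewrite Fi /=.
case/esym/andP => /domP[u Fa] /domP[v Fb]; exists u, v; split=> //.
exact/(edge_mapP _ Fc (erefl (edge_of i)) Fa Fb).
Qed.

Lemma edge_map_in F : F \in cps_card G (leq 3) -> edge_map F \in partial_injs n.
Proof.
rewrite !inE => /andP[Fc F3]; apply/andP; split.
  apply/partial_injP => i i' j Fi Fi'; apply: ed_inj.
  have [u [v [Fa Fb ej]]] := edge_map_edge Fc Fi.
  have [u' [v' [Fa' Fb' ej']]] := edge_map_edge Fc Fi'.
  move: ej'; rewrite ej /edge_of => /set2_eq_cases[] [? ?]; subst u' v'.
    by rewrite (cps_inj Fc Fa Fa') (cps_inj Fc Fb Fb').
  by rewrite (cps_inj Fc Fa Fb') (cps_inj Fc Fb Fa') setUC.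
have /and3P[_ /set0Pn[x xF] conn] := Fc.
have [y yF xy] := connected_neighbour conn (ltnW F3) xF.
have [z zF /and3P[zx zy xyz]] := connected_third conn F3 xF yF xy.
(* [w] is an end of the edge [xy] adjacent to the third vertex [z]; the edges [xy] and [wz] are the
   two required ones. *)
have [w [wF wz wxy]] : exists w, [/\ w \in dom F, adj w z & w \in [set x; y]].
  by case/orP: xyz => ?; [exists x; rewrite set21 | exists y; rewrite set22].
have [[i ei] [j ej]] := (ed_ex xy, ed_ex wz).
have ed_dom k u v : edge_of k = [set u; v] -> u \in dom F -> v \in dom F -> edge_map F k.
  move=> ek uF vF; rewrite edge_map_dom //.
  by case/set2_eq_cases: ek => -[-> ->]; rewrite uF vF.
have ij : i != j.
  apply: contraTneq (set22 w z) => eij; rewrite -ej -eij ei.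
  by rewrite !inE negb_or zx.
have <- : #|[set i; j]| = 2 by rewrite cards2 ij.
apply: subset_leq_card; apply/subsetP => k /set2P[] ->; rewrite inE.
  exact: ed_dom ei xF yF.
exact: ed_dom ej wF zF.
Qed.

(** Both functions send the edge [xy] to the same edge, which leaves only a possible swap of the two
    images. *)
Lemma edge_map_eq F F' x y :
  cps F -> cps F' -> edge_map F = edge_map F' -> adj x y ->
  x \in dom F -> y \in dom F ->
  [/\ x \in dom F', y \in dom F'
    & F x = F' x /\ F y = F' y \/ F x = F' y /\ F y = F' x].
Proof.
move=> Fc Fc' eqF xy /domP[u Fx] /domP[v Fy].
have [i ei] := ed_ex xy.
have [j ej] : exists j, edge_of j = [set u; v] by apply: ed_ex; rewrite (cps_adj Fc Fx Fy).
have Fi : edge_map F' i = Some j by rewrite -eqF; apply/(edge_mapP _ Fc ei Fx Fy).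
have [u' [v' [Fa Fb]]] := edge_map_edge Fc' Fi; rewrite ej => e.
case/set2_eq_cases: ei => -[eqx eqy]; rewrite eqx eqy in Fa Fb;
  rewrite !inE Fx Fy Fa Fb; split=> //; case/set2_eq_cases: e => -[-> ->];
  solve [by left | by right].
Qed.

Lemma edge_map_inj : {in cps_card G (leq 3) &, injective edge_map}.
Proof.
move=> F F'; rewrite !inE => /andP[Fc F3] /andP[Fc' F3'] eqF.
have eqdom : dom F = dom F'.
  (* Every vertex of the domain lies on an edge inside it, so the edge map determines the domain. *)
  suff sub H H' : cps H -> cps H' -> 2 < #|dom H| -> edge_map H = edge_map H' ->
      dom H \subset dom H' by apply/eqP; rewrite eqEsubset !sub.
  move=> Hc Hc' H3 eqH; apply/subsetP => x xH; have /and3P[_ _ conn] := Hc.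
  have [y yH xy] := connected_neighbour conn (ltnW H3) xH.
  by have [] := edge_map_eq Hc Hc' eqH xy xH yH.
have /and3P[_ _ conn] := Fc.
have swap := edge_map_eq Fc Fc' eqF.
(* Swaps on both [xy] and [xz] would give [F y = F' x = F z], against injectivity of [F]. *)
have fork x y z : adj x y -> adj x z -> z != y ->
    x \in dom F -> y \in dom F -> z \in dom F -> F x = F' x.
  move=> xy xz zy xF yF zF.
  have [_ _ [[]//|[_ Fy]]] := swap _ _ xy xF yF.
  have [_ _ [[]//|[_ Fz]]] := swap _ _ xz xF zF.
  have [u Fu] := domP _ _ yF; case/eqP: zy.
  by apply: (cps_inj Fc _ Fu); rewrite Fz -Fy.
apply/ffunP => x; have [xF|] := boolP (x \in dom F); last first.
  move=> xF; have := xF; rewrite eqdom; move: xF; rewrite !inE.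
  by case: (F x) => // _; case: (F' x).
have [y yF xy] := connected_neighbour conn (ltnW F3) xF.
have [z zF /and3P[zx zy /orP[xz|yz]]] := connected_third conn F3 xF yF xy.
  exact: fork xy xz zy xF yF zF.
(* Here [y] has the two neighbours [x] and [z], so [F y = F' y]; even under a swap,
   [F x = F' y = F y = F' x]. *)
have [_ _ [[]//|[Fx Fy]]] := swap _ _ xy xF yF.
have yx : adj y x by rewrite adj_sym.
by rewrite Fx -(fork _ _ _ yx yz zx yF xF zF) Fy.
Qed.

Lemma card_cps3 : #|cps_card G (leq 3)| <= #|partial_injs n|.
Proof.
rewrite -(card_in_imset edge_map_inj); apply: subset_leq_card.
by apply/subsetP => p /imsetP[F /edge_map_in ? ->].
Qed.

(** * Equality on domains with at least three vertices *)

(** The cardinalities force [edge_map] to be onto [partial_injs n]; [U] is the domain of a preimage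
    of the identity on [[set i; j]]. *)
Lemma cps3_two_edges :
  #|partial_injs n| <= #|cps_card G (leq 3)| ->
  forall i j, i != j -> exists U : {set G},
    connected (induced U) /\
    forall k, (edge_of k \subset U) = (k \in [set i; j]).
Proof.
move=> le i j ij.
pose p : {ffun 'I_n -> option 'I_n} := [ffun k => if k \in [set i; j] then Some k else None].
have dp : [set k | p k] = [set i; j].
  by apply/setP => k; rewrite inE ffunE; case: ifP.
have : p \in partial_injs n.
  rewrite inE dp cards2 ij andbT; apply/partial_injP => k l m; rewrite !ffunE.
  by case: ifP => // _ [->]; case: ifP => // _ [->].
have -> : partial_injs n = edge_map @: cps_card G (leq 3).
  apply/esym/eqP; rewrite eqEcard (card_in_imset edge_map_inj) le andbT.
  by apply/subsetP => q /imsetP[F /edge_map_in ? ->].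
case/imsetP => F; rewrite inE => /andP[Fc _] pF.
exists (dom F); split; first by case/and3P: Fc.
by move=> k; rewrite -dp inE pF edge_map_dom // subUset !sub1set.
Qed.

Lemma two_edges_meet :
  #|partial_injs n| <= #|cps_card G (leq 3)| ->
  forall i j, i != j -> exists c x y,
    [/\ edge_of i = [set c; x], edge_of j = [set c; y], x != y & ~~ adj x y].
Proof.
move=> le i j ij; have [U [Uc edU]] := cps3_two_edges le ij.
have Ui : edge_of i \subset U by rewrite edU set21.
have Uj : edge_of j \subset U by rewrite edU set22.
have edge_in x y : x \in U -> y \in U -> adj x y ->
    [set x; y] = edge_of i \/ [set x; y] = edge_of j.
  move=> xU yU /ed_ex[k ek].
  have : edge_of k \subset U by rewrite ek subUset !sub1set xU.
  by rewrite edU -ek => /set2P[] ->; [left | right].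
(* If the edges were disjoint, the ends of [i] would be closed under adjacency in [U], leaving no
   room for [j]. *)
have [c ci cj] : exists2 c, c \in edge_of i & c \in edge_of j.
  apply/exists_inP; apply: contraT => /exists_inPn disj.
  have aiU : a i \in U by rewrite (subsetP Ui) ?set21.
  suff /subsetP/(_ (a j)) : U \subset edge_of i.
    rewrite (subsetP Uj) ?set21 // => /(_ isT) /disj.
    by rewrite set21.
  have ai : a i \in edge_of i by apply: set21.
  apply: connected_closed Uc aiU ai _ => x y xU yU xi xy.
  have [e|e] := edge_in _ _ xU yU xy; first by rewrite -e set22.
  by have := disj x xi; rewrite -e set21.
have other k : c \in edge_of k -> exists x, edge_of k = [set c; x].
  by case/set2P => ->; [exists (b k) | exists (a k); rewrite setUC].
have [[x ex] [y ey]] := (other i ci, other j cj).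
have xy : x != y by apply: contraNneq ij => e; apply/eqP/ed_inj; rewrite ex ey e.
exists c, x, y; split=> //; apply/negP => axy.
have cx := adj_ed ex; have cy := adj_ed ey.
have xU : x \in U by rewrite (subsetP Ui) // ex set22.
have yU : y \in U by rewrite (subsetP Uj) // ey set22.
(* An edge [xy] would be a third edge in [U]: it is neither [cx] nor [cy]. *)
have [] := edge_in _ _ xU yU axy; rewrite ?ex ?ey => e.
  by have := set22 x y; rewrite e !inE; case: eqP cy => [->|_ _];
    rewrite ?adj_irr // eq_sym (negbTE xy).
by have := set21 x y; rewrite e !inE; case: eqP cx => [->|_ _];
  rewrite ?adj_irr // (negbTE xy).
Qed.

Lemma common_endpoint :
  0 < #|G| -> #|partial_injs n| <= #|cps_card G (leq 3)| ->
  exists c, forall i, c \in edge_of i.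
Proof.
move=> /card_gt0P[r _] /two_edges_meet meet.
(* With a single edge any of its ends will do, and with no edge any vertex [r]. *)
case: (pickP [pred q : 'I_n * 'I_n | q.1 != q.2]) => [[i j] /= ij|eqs]; last first.
  have [i _|none] := pickP 'I_n; last by exists r => i; have := none i.
  by exists (a i) => j; have := eqs (i, j) => /= /negbFE/eqP <-; apply: set21.
have [c [x [y [ei ej xy nadj]]]] := meet i j ij.
have touch k l z :
    c \in edge_of k -> edge_of k = [set c; z] -> c \notin edge_of l -> z \in edge_of l.
  move=> ck ek cl; have kl : k != l by apply: contraNneq cl => <-.
  have [d [? [? [edk edl _ _]]]] := meet k l kl.
  have : d \in [set c; z] by rewrite -ek edk set21.
  have dl : d \in edge_of l by rewrite edl set21.
  by case/set2P=> e; [case/negP: cl; rewrite -e | rewrite -e].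
(* An edge [k] avoiding [c] must meet both [cx] and [cy], hence joins [x] and [y], which are not
   adjacent. *)
exists c => k; apply: contraT => ck.
have xk : x \in edge_of k by apply: (touch i k x _ ei ck); rewrite ei set21.
have yk : y \in edge_of k by apply: (touch j k y _ ej ck); rewrite ej set21.
case/set2P: xk yk xy nadj => -> /set2P[] ->; rewrite ?eqxx // ?adj_ab //.
by rewrite adj_sym adj_ab.
Qed.

End EdgeFamily.

(** * Enumerating the edges and bounding the order *)

Lemma edge_family_exists (G : sgraph) :
  exists a b : 'I_#|edges G| -> G, edge_family a b.
Proof.
have [q qP] : exists q : 'I_#|edges G| -> G * G,
    forall i, adj (q i).1 (q i).2 /\ enum_val i = [set (q i).1; (q i).2].
  apply: (fin_all_exists
    (P := fun i (r : G * G) => adj r.1 r.2 /\ enum_val i = [set r.1; r.2])) => i.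
  have := enum_valP i; rewrite inE => /existsP[x /existsP[y /andP[xy /eqP e]]].
  by exists (x, y).
exists (fun i => (q i).1), (fun i => (q i).2); split=> [i|i j|x y xy].
- by case: (qP i).
- by rewrite /edge_of -(proj2 (qP i)) -(proj2 (qP j)) => /enum_val_inj.
have e : [set x; y] \in edges G.
  by rewrite inE; apply/existsP; exists x; apply/existsP; exists y; rewrite xy /=.
by exists (enum_rank_in e [set x; y]); rewrite /edge_of -(proj2 (qP _)) enum_rankK_in.
Qed.

(* h is the distance to r. *)
Lemma connected_parent (G : sgraph) (r : G) :
  connected G -> exists h : G -> nat,
    forall v, v != r -> exists2 w, adj v w & h w < h v.
Proof.
move=> /forallP/(_ r)/forallP conn.
pose P v k := [exists p : k.-tuple G, path (@adj G) r p && (last r p == v)].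
have exP v : exists k, P v k.
  have /connectP[p rp ->] := conn v.
  by exists (size p); apply/existsP; exists (in_tuple p); rewrite rp /=.
exists (fun v => ex_minn (exP v)) => v vr.
case: ex_minnP => k /existsP[[p /= /eqP <-] /andP[+ /eqP lastp]] _.
case: (lastP p) lastp => [/= e|q z]; first by rewrite e eqxx in vr.
rewrite last_rcons size_rcons rcons_path => -> /andP[rq qv].
exists (last r q); first by rewrite adj_sym.
case: ex_minnP => m _ /(_ (size q)) H; rewrite ltnS; apply: H.
by apply/existsP; exists (in_tuple q); rewrite rq /=.
Qed.

(** Each vertex other than [r] is charged to an edge leading closer to [r], and [r] itself to
    [None], the extra point of [option 'I_n]. *)
Lemma card_vertices_le n (G : sgraph) (a b : 'I_n -> G) :
  edge_family a b -> connected G -> #|G| <= n.+1.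
Proof.
move=> [_ _ ed_ex] conn; have [r _|none] := pickP G; last by rewrite eq_card0.
have [h hP] := connected_parent r conn.
pose good v i := [exists w, (edge_of a b i == [set v; w]) && (h w < h v)].
pose f v := if v == r then None else [pick i | good v i].
have f_None v : f v = None -> v = r.
  rewrite /f; case: eqVneq => // /hP[w vw hw].
  have [i ei] := ed_ex _ _ vw; case: pickP => // /(_ i)/existsP[].
  by exists w; rewrite ei eqxx.
have f_Some v i : f v = Some i -> exists2 w, edge_of a b i = [set v; w] & h w < h v.
  rewrite /f; case: eqP => // _; case: pickP => // j + [<-].
  by case/existsP=> w /andP[/eqP ej hw]; exists w.
have f_inj : injective f.
  move=> v w; case fv: (f v) => [i|] /esym fw; last first.
    by rewrite (f_None _ fv) (f_None _ fw).
  have [x + hx] := f_Some _ _ fv; have [y -> hy] := f_Some _ _ fw.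
  (* An edge charged from both ends would make each end strictly closer to [r] than the other. *)
  case/set2_eq_cases => -[// wx yv]; subst x y.
  by have := ltn_trans hx hy; rewrite ltnn.
by have := leq_card f f_inj; rewrite card_option card_ord.
Qed.

(** * The star: attaining the bound and recognising it *)

Lemma star_edge_family n :
  @edge_family n (star n) (fun=> None) Some.
Proof.
split=> // [i j|[x|] [y|] //= _].
- move=> e; have : (Some i : star n) \in @edge_of n (star n) (fun=> None) Some i by apply: set22.
  by rewrite e => /set2P[] // [].
- by exists x; rewrite /edge_of setUC.
- by exists y.
Qed.

(** A partial injection of the rays extends to a partial symmetry fixing the centre, which is the
    third vertex beside two ray ends. *)
Lemma partial_injs_star n : #|partial_injs n| <= #|cps_card (star n) (leq 3)|.
Proof.
pose psi (p : {ffun 'I_n -> option 'I_n}) : {ffun star n -> option (star n)} :=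
  [ffun x => if x is Some i then omap Some (p i) else Some None].
have psi_inj : injective psi.
  move=> p q e; apply/ffunP => i; have /ffunP/(_ (Some i)) := e; rewrite !ffunE.
  by case: (p i) (q i) => [u|] [v|] //= [->].
rewrite -(card_imset _ psi_inj); apply: subset_leq_card.
apply/subsetP => F /imsetP[p + ->]; rewrite !inE => /andP[/partial_injP pinj p2].
have dom_psi : dom (psi p) = None |: Some @: [set i | p i].
  apply/setP => -[i|]; rewrite !inE ffunE //= mem_imset ?inE; last by move=> ? ? [].
  by case: (p i).
have cd : 2 < #|dom (psi p)|.
  rewrite dom_psi cardsU1 card_imset; last by move=> ? ? [].
  have -> : (None : star n) \notin Some @: [set i | p i] by apply/imsetP => -[].
  by rewrite add1n ltnS.
rewrite cd andbT; apply/and3P; split.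
- apply/preserves_adjP => x y u v; rewrite !ffunE.
  case: x y => [i|] [j|] /=.
  + case pi: (p i) => [k|] //= [<-]; case pj: (p j) => [l|] //= [<-]; split=> //.
    apply/eqP/eqP => [[kl]|[ij]]; last by move: pj; rewrite -ij pi => -[->].
    by rewrite (pinj i j k) // pj kl.
  + by case: (p i) => //= k [<-] [<-].
  + by move=> [<-]; case: (p j) => //= k [<-].
  + by move=> [<-] [<-].
- by rewrite -card_gt0; apply: leq_trans cd.
- apply: (@connected_hub _ _ (None : star n)); first by rewrite dom_psi setU11.
  by case.
Qed.

Lemma isomorphic_star n (G : sgraph) (a b : 'I_n -> G) c :
  edge_family a b -> connected G -> (forall i, c \in edge_of a b i) ->
  isomorphic G (star n).
Proof.
move=> ef conn cP; have [ab ed_inj ed_ex] := ef.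
have edge_c x y : adj x y -> (x == c) || (y == c).
  by case/ed_ex => i ei; have := cP i; rewrite ei !inE !(eq_sym c).
(* A path from [x] to [c] starts with an edge at [x], whose other end can only be [c]. *)
have adj_c x : x != c -> adj c x.
  move=> xc; have /connectP[[/= _ e|y p /= /andP[xy _] _]] := forallP (forallP conn x) c.
    by rewrite e eqxx in xc.
  by have := edge_c _ _ xy; rewrite (negbTE xc) /= => /eqP <-; rewrite adj_sym.
have adjE x y : adj x y = (x == c) (+) (y == c).
  have [->|xc] := eqVneq x c; have [->|yc] := eqVneq y c; rewrite ?adj_irr //=.
  - exact: adj_c.
  - by rewrite adj_sym adj_c.
  - by apply/negP => /edge_c; rewrite (negbTE xc) (negbTE yc).
(* [x] goes to the index of the edge [cx]; no edge joins [c] to itself, so [c] goes to the centre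
   [None]. *)
pose f : {ffun G -> star n} := [ffun x => [pick i | edge_of a b i == [set c; x]]].
have f_Some x i : f x = Some i -> edge_of a b i = [set c; x].
  by rewrite ffunE; case: pickP => // j /eqP ej [<-].
have f_None x : (f x == None) = (x == c).
  rewrite ffunE; case: pickP => [i /eqP ei|none].
    by apply/esym; apply: contraTF (adj_ed ef ei) => /eqP ->; rewrite adj_irr.
  apply/esym/eqP/eqP; apply: contraT => xc.
  by have [i ei] := ed_ex _ _ (adj_c _ xc); have := none i; rewrite ei eqxx.
exists f; apply/and3P; split.
- apply/injectiveP => x y; case fx: (f x) => [i|] fy.
    have := f_Some _ _ fx; rewrite (f_Some y i (esym fy)).
    by case/set2_eq_cases => [[]|[<- ->]].
  have /eqP := fx; rewrite f_None => /eqP ->.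
  by move/esym/eqP: fy; rewrite f_None => /eqP ->.
- apply/forallP => -[i|]; apply/existsP; last by exists c; rewrite f_None.
  have [x ex] : exists x, edge_of a b i = [set c; x].
    by case/set2P: (cP i) => ->; [exists (b i) | exists (a i); rewrite setUC].
  exists x; case fx: (f x) => [j|].
    by rewrite (ed_inj j i) ?eqxx // (f_Some _ _ fx).
  move/eqP: fx; rewrite f_None => /eqP xc.
  by have := adj_ed ef ex; rewrite xc adj_irr.
- apply/forallP => x; apply/forallP => y.
  by rewrite adjE /= /star_adj !f_None.
Qed.

Theorem theorem1 (n : nat) (G : sgraph)
    (G_connected : connected G) (G_size : #|edges G| = n) :
  copsi G <= copsi (star n) /\
  (copsi G = copsi (star n) -> isomorphic G (star n)).
Proof.
subst n; have [a [b ef]] := edge_family_exists G.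
have sf := @star_edge_family #|edges G|.
have leV := card_vertices_le ef G_connected; have le3 := card_cps3 ef.
have ge3 := @partial_injs_star #|edges G|.
rewrite !copsi_sum !card_cps1 (card_cps2 ef) (card_cps2 sf).
have -> : #|star #|edges G| | = #|edges G|.+1 by rewrite card_option card_ord.
have leV2 : #|G| ^ 2 <= #|edges G|.+1 ^ 2 by rewrite leq_sqr.
have le3' := leq_trans le3 ge3.
split=> [|eq]; first by rewrite !leq_add.
(* Adding the inequalities as [leqif] keeps track of equality: equal sums force equality in each
   summand. *)
have [_] := leqif_add (leqif_add (leqif_eq leV2) (leqif_eq (leqnn (2 * #|edges G| ^ 2))))
                      (leqif_eq le3').
rewrite eq !eqxx andbT => /esym/andP[/eqP eqV /eqP eq3].
have [c cP] : exists c, forall i, c \in edge_of a b i.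
  apply: common_endpoint ef _ _; last by rewrite eq3.
  (* [G] has a vertex because the square of its order is [#|edges G|.+1 ^ 2]. *)
  by rewrite -(ltn_sqr 0) eqV.
exact: isomorphic_star ef G_connected cP.
Qed.
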